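(* Let $G$ be a finite group scheme over $k$, and let $J$ be a twist for $k[G]$. Then $J$ is minimal if and only if it is nondegenerate.
   Context: $k$ is an algebraically closed field of characteristic $p\ge 0$. A finite group scheme $G$ over $k$ is an affine group scheme whose coordinate Hopf algebra $\mathcal{O}(G)$ is finite dimensional; $k[G]=\mathcal{O}(G)^*$ is its (cocommutative) group algebra. A twist for a Hopf algebra $B$ is an invertible $J\in B\otimes B$ with $(\Delta\otimes id)(J)(J\otimes 1)=(id\otimes\Delta)(J)(1\otimes J)$ and $(\varepsilon\otimes id)(J)=(id\otimes\varepsilon)(J)=1$. $B^J$ is the Hopf algebra with the algebra structure of $B$ and comultiplication $\Delta^J(b)=J^{-1}\Delta(b)J$; for $B$ cocommutative, $(B^J,J_{21}^{-1}J)$ is a triangular Hopf algebra. The twist $J$ for $k[G]$ is minimal if the triangular Hopf algebra $(k[G]^J,J_{21}^{-1}J)$ is minimal, i.e. the left (equivalently right) tensorands of $J_{21}^{-1}J$ span $k[G]$. The twist $J$ is nondegenerate if the coalgebra $k[G]_J$, which is $k[G]$ with comultiplication $\Delta_J(b)=\Delta(b)J$, is simple, i.e. its category of finite dimensional comodules is equivalent to $\mathrm{Vec}$. *)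

(* Defs.v *)
From HB Require Import structures.
From mathcomp Require Import all_boot all_order all_algebra all_field.

Set Implicit Arguments.
Unset Strict Implicit.
Unset Printing Implicit Defensive.

Import GRing.Theory.
Local Open Scope ring_scope.

Declare Scope tensor_scope.
Delimit Scope tensor_scope with T.
Local Open Scope tensor_scope.

Reserved Notation "A ⊗ B" (at level 40, left associativity).

(* A ⊗ B is modelled by the coordinate matrices of tensors in the bases
   vbasis {:A} and vbasis {:B}. Only [tens], [tlift] and the universal property
   [tlift_tens], [tens_ind] are meant to be used; they do not mention bases. *)
Definition tensor (k : fieldType) (A B : vectType k) : Type :=
  'M[k]_(\dim {:A}, \dim {:B}).
Notation "A ⊗ B" := (tensor A B) : type_scope.

HB.instance Definition _ (k : fieldType) (A B : vectType k) :=
  Vector.copy (A ⊗ B)%type 'M[k]_(\dim {:A}, \dim {:B}).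

Definition tens (k : fieldType) (A B : vectType k) (a : A) (b : B) :
    (A ⊗ B)%type :=
  \matrix_(i, j) (coord (vbasis {:A}) i a * coord (vbasis {:B}) j b).
Notation "a ⊗ b" := (tens a b) : tensor_scope.

(* For f bilinear, the unique linear map sending a ⊗ b to f a b. *)
Definition tlift (k : fieldType) (A B C : vectType k) (f : A -> B -> C)
    (t : (A ⊗ B)%type) : C :=
  \sum_i \sum_j t i j *: f (vbasis {:A})`_i (vbasis {:B})`_j.

Section TensorTheory.
Variables (k : fieldType).
Implicit Types (A B C D : vectType k).

Lemma tlift_is_linear A B C (f : A -> B -> C) : linear (tlift f).
Proof.
move=> c s t; rewrite /tlift scaler_sumr -big_split; apply: eq_bigr => i _ /=.
rewrite scaler_sumr -big_split; apply: eq_bigr => j _ /=.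
by rewrite !mxE scalerDl scalerA.
Qed.
HB.instance Definition _ A B C (f : A -> B -> C) :=
  GRing.isLinear.Build k (A ⊗ B)%type C _ (tlift f) (tlift_is_linear f).

Lemma tens_is_linearl A B (b : B) : linear (fun a : A => a ⊗ b).
Proof.
by move=> c x y; apply/matrixP=> i j; rewrite !mxE linearP mulrDl mulrA.
Qed.
Lemma tens_is_linearr A B (a : A) : linear (fun b : B => a ⊗ b).
Proof.
move=> c x y; apply/matrixP=> i j; rewrite !mxE linearP mulrDr.
by rewrite mulrCA.
Qed.

HB.instance Definition _ A B (a : A) :=
  GRing.isLinear.Build k B (A ⊗ B)%type _ (@tens k A B a) (tens_is_linearr a).

Lemma tensDl A B (x y : A) (b : B) : (x + y) ⊗ b = x ⊗ b + y ⊗ b.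
Proof. by have := tens_is_linearl b 1 x y; rewrite !scale1r. Qed.
Lemma tensZl A B c (x : A) (b : B) : (c *: x) ⊗ b = c *: (x ⊗ b).
Proof. by apply/matrixP=> i j; rewrite !mxE linearZ -mulrA. Qed.
Lemma tensDr A B (a : A) (x y : B) : a ⊗ (x + y) = a ⊗ x + a ⊗ y.
Proof. exact: raddfD. Qed.
Lemma tensZr A B c (a : A) (x : B) : a ⊗ (c *: x) = c *: (a ⊗ x).
Proof. exact: linearZ. Qed.
Lemma tens0l A B (b : B) : (0 : A) ⊗ b = 0.
Proof. by rewrite -(scale0r 0) tensZl scale0r. Qed.
Lemma tens_suml A B I (r : seq I) (F : I -> A) (b : B) :
  (\sum_(i <- r) F i) ⊗ b = \sum_(i <- r) F i ⊗ b.
Proof.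
by apply: (big_morph (fun a => a ⊗ b)) => [x y|]; rewrite ?tensDl ?tens0l.
Qed.

Lemma coord_sum A (a : A) :
  a = \sum_i coord (vbasis {:A}) i a *: (vbasis {:A})`_i.
Proof. exact: coord_vbasis (memvf a). Qed.

Lemma coord_neq0 A (a : A) :
  a != 0 -> exists i, coord (vbasis {:A}) i a != 0.
Proof.
move=> /eqP a0.
have [/forallP h|] := boolP [forall i, coord (vbasis {:A}) i a == 0].
  by case: a0; rewrite (coord_sum a) big1 // => i _; rewrite (eqP (h i)) scale0r.
by rewrite negb_forall => /existsP.
Qed.

Lemma coord_basis A (i j : 'I_(\dim {:A})) :
  coord (vbasis {:A}) i (vbasis {:A})`_j = (i == j)%:R.
Proof. by rewrite (coord_free _ _ (basis_free (vbasisP _))) eq_sym. Qed.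

Lemma tlift_tens A B C (f : A -> B -> C) :
    (forall b, linear (f^~ b)) -> (forall a, linear (f a)) ->
  forall a b, tlift f (a ⊗ b) = f a b.
Proof.
move=> fl fr a b.
pose fL b : {linear A -> C} :=
  HB.pack (f^~ b) (GRing.isLinear.Build k A C _ (f^~ b) (fl b)).
pose fR a : {linear B -> C} :=
  HB.pack (f a) (GRing.isLinear.Build k B C _ (f a) (fr a)).
rewrite [in RHS](coord_sum a) -[RHS]/(fL b _) linear_sum.
apply: eq_bigr => i _; rewrite linearZ /=.
rewrite [in RHS](coord_sum b) -[f _ _]/(fR _ _) linear_sum scaler_sumr.
by apply: eq_bigr => j _; rewrite linearZ /= mxE scalerA.
Qed.

Lemma tensor_sum A B (t : (A ⊗ B)%type) :
  t = \sum_i \sum_j t i j *: ((vbasis {:A})`_i ⊗ (vbasis {:B})`_j).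
Proof.
rewrite [LHS]matrix_sum_delta; apply: eq_bigr => i _; apply: eq_bigr => j _.
congr (_ *: _); apply/matrixP => x y; rewrite !mxE !coord_basis.
by rewrite -natrM mulnb.
Qed.

Lemma tens_ind A B (P : (A ⊗ B)%type -> Prop) :
    P 0 -> (forall s t, P s -> P t -> P (s + t)) ->
    (forall a b, P (a ⊗ b)) ->
  forall t, P t.
Proof.
move=> P0 PD Pt t; rewrite (tensor_sum t).
apply: (big_ind P) => // i _; apply: (big_ind P) => // j _.
by rewrite -tensZl.
Qed.

Lemma tens_ext A B C (f g : {linear (A ⊗ B)%type -> C}) :
  (forall a b, f (a ⊗ b) = g (a ⊗ b)) -> f =1 g.
Proof.
move=> fg; elim/tens_ind => [|s t hs ht|//]; first by rewrite !linear0.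
by rewrite !linearD hs ht.
Qed.

Lemma eq_tlift A B C (f g : A -> B -> C) :
  (forall a b, f a b = g a b) -> tlift f =1 tlift g.
Proof.
by move=> fg t; apply: eq_bigr => i _; apply: eq_bigr => j _; rewrite fg.
Qed.

Lemma linear_tlift A B C D (h : {linear C -> D}) (f : A -> B -> C) t :
  h (tlift f t) = tlift (fun a b => h (f a b)) t.
Proof.
rewrite linear_sum; apply: eq_bigr => i _; rewrite linear_sum.
by apply: eq_bigr => j _; rewrite linearZ.
Qed.

Lemma tlift_tlift A B C D (E : vectType k) (g : C -> D -> E) (f : A -> B -> (C ⊗ D)%type) t :
  tlift g (tlift f t) = tlift (fun a b => tlift g (f a b)) t.
Proof. exact: linear_tlift. Qed.

Lemma tlift_eq0 A B C (f : A -> B -> C) t :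
  (forall a b, f a b = 0) -> tlift f t = 0.
Proof. by move=> f0; do 2!apply: big1 => ? _; rewrite f0 scaler0. Qed.

Lemma tliftD A B C (f g : A -> B -> C) t :
  tlift (fun a b => f a b + g a b) t = tlift f t + tlift g t.
Proof.
rewrite -big_split; apply: eq_bigr => i _; rewrite -big_split.
by apply: eq_bigr => j _; rewrite scalerDr.
Qed.

Lemma tliftZ A B C c (f : A -> B -> C) t :
  tlift (fun a b => c *: f a b) t = c *: tlift f t.
Proof.
rewrite scaler_sumr; apply: eq_bigr => i _; rewrite scaler_sumr.
by apply: eq_bigr => j _; rewrite scalerA mulrC -scalerA.
Qed.

Lemma tlift_exchange A B C D (E : vectType k) (f : A -> B -> C -> D -> E) s t :
  tlift (fun a b => tlift (f a b) t) s =
  tlift (fun c d => tlift (fun a b => f a b c d) s) t.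
Proof.
rewrite /tlift.
under eq_bigr do under eq_bigr do rewrite scaler_sumr.
under eq_bigr do under eq_bigr do under eq_bigr do rewrite scaler_sumr.
under [RHS]eq_bigr do under eq_bigr do rewrite scaler_sumr.
under [RHS]eq_bigr do under eq_bigr do under eq_bigr do rewrite scaler_sumr.
under eq_bigr do rewrite exchange_big.
rewrite exchange_big; apply: eq_bigr => i _.
under eq_bigr do rewrite exchange_big.
rewrite exchange_big; apply: eq_bigr => j _; apply: eq_bigr => x _.
by apply: eq_bigr => y _; rewrite !scalerA mulrC.
Qed.

End TensorTheory.

Section TensorMaps.
Variables (k : fieldType).
Implicit Types (A B C D : vectType k).

Definition tmap A B C D (f : A -> C) (g : B -> D) : (A ⊗ B -> C ⊗ D)%type :=
  tlift (fun a b => f a ⊗ g b).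
HB.instance Definition _ A B C D (f : A -> C) (g : B -> D) :=
  GRing.isLinear.Build k (A ⊗ B)%type (C ⊗ D)%type _ (tmap f g)
    (tlift_is_linear (fun a b => f a ⊗ g b)).

Lemma tmap_tens A B C D (f : {linear A -> C}) (g : {linear B -> D}) a b :
  tmap f g (a ⊗ b) = f a ⊗ g b.
Proof.
apply: tlift_tens => [y|x] c u v.
  by rewrite linearP tensDl tensZl.
by rewrite linearP tensDr tensZr.
Qed.

Definition tswap A B : (A ⊗ B -> B ⊗ A)%type := tlift (fun a b => b ⊗ a).
HB.instance Definition _ A B :=
  GRing.isLinear.Build k (A ⊗ B)%type (B ⊗ A)%type _ (@tswap A B)
    (tlift_is_linear (fun a b => b ⊗ a)).

Lemma tswap_tens A B (a : A) (b : B) : tswap (a ⊗ b) = b ⊗ a.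
Proof.
by apply: tlift_tens => [y|x] c u v; rewrite ?tensDr ?tensZr ?tensDl ?tensZl.
Qed.

Definition tassoc A B C : ((A ⊗ B) ⊗ C -> A ⊗ (B ⊗ C))%type :=
  tlift (fun t c => tlift (fun a b => a ⊗ (b ⊗ c)) t).
HB.instance Definition _ A B C :=
  GRing.isLinear.Build k ((A ⊗ B) ⊗ C)%type (A ⊗ (B ⊗ C))%type _ (@tassoc A B C)
    (tlift_is_linear (fun t c => tlift (fun a b => a ⊗ (b ⊗ c)) t)).

Lemma tassoc_tens A B C (a : A) (b : B) (c : C) :
  tassoc ((a ⊗ b) ⊗ c) = a ⊗ (b ⊗ c).
Proof.
rewrite /tassoc tlift_tens.
- by rewrite tlift_tens // => y d u v;
    rewrite ?tensDl ?tensZl ?tensDr ?tensZr.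
- by move=> y d u v; rewrite linearP.
- move=> t d u v; rewrite -tliftZ -tliftD; apply: eq_tlift => x y.
  by rewrite !tensDr !tensZr.
Qed.

End TensorMaps.

Section TensorAlgebra.
Variables (k : fieldType) (A B : falgType k).
Local Notation AB := (A ⊗ B)%type.

Definition tmul (s t : AB) : AB :=
  tlift (fun a b => tlift (fun a' b' => (a * a') ⊗ (b * b')) t) s.
Definition tone : AB := 1 ⊗ 1.

Lemma tmul_tens a b a' b' : tmul (a ⊗ b) (a' ⊗ b') = (a * a') ⊗ (b * b').
Proof.
rewrite /tmul tlift_tens.
- rewrite tlift_tens // => y c u v.
    by rewrite mulrDr -scalerAr tensDl tensZl.
  by rewrite mulrDr -scalerAr tensDr tensZr.
- move=> y c u v; rewrite -tliftZ -tliftD; apply: eq_tlift => a1 b1.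
  by rewrite mulrDl -scalerAl tensDl tensZl.
- move=> y c u v; rewrite -tliftZ -tliftD; apply: eq_tlift => a1 b1.
  by rewrite mulrDl -scalerAl tensDr tensZr.
Qed.

Lemma tmulDl : left_distributive tmul +%R.
Proof. by move=> s s' t; rewrite /tmul raddfD. Qed.
Lemma tmulDr : right_distributive tmul +%R.
Proof.
by move=> s t t'; rewrite /tmul -tliftD; apply: eq_tlift => a b; rewrite raddfD.
Qed.
Lemma tmulZl c s t : c *: tmul s t = tmul (c *: s) t.
Proof. by rewrite /tmul linearZ. Qed.
Lemma tmulZr c s t : c *: tmul s t = tmul s (c *: t).
Proof. by rewrite /tmul -tliftZ; apply: eq_tlift => a b; rewrite linearZ. Qed.
Lemma tmul0l t : tmul 0 t = 0. Proof. by rewrite /tmul raddf0. Qed.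
Lemma tmul0r t : tmul t 0 = 0.
Proof. by rewrite -[X in tmul t X](scale0r (0 : AB)) -tmulZr scale0r. Qed.

Lemma tmulA : associative tmul.
Proof.
move=> s t u; elim/tens_ind: s => [|s s' hs hs'|a b].
- by rewrite !tmul0l.
- by rewrite !tmulDl hs hs'.
elim/tens_ind: t => [|t t' ht ht'|a' b'].
- by rewrite !(tmul0l, tmul0r).
- by rewrite !(tmulDl, tmulDr) ht ht'.
elim/tens_ind: u => [|u u' hu hu'|a'' b''].
- by rewrite !tmul0r.
- by rewrite !tmulDr hu hu'.
by rewrite !tmul_tens !mulrA.
Qed.

Lemma tmul1l : left_id tone tmul.
Proof.
elim/tens_ind => [|t t' ht ht'|a b]; rewrite ?tmul0r ?tmulDr ?ht ?ht' //.
by rewrite tmul_tens !mul1r.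
Qed.
Lemma tmul1r : right_id tone tmul.
Proof.
elim/tens_ind => [|t t' ht ht'|a b]; rewrite ?tmul0l ?tmulDl ?ht ?ht' //.
by rewrite tmul_tens !mulr1.
Qed.

Lemma tone_neq0 : tone != 0.
Proof.
apply/eqP => /matrixP t0.
have [i ci] := coord_neq0 (oner_neq0 A); have [j cj] := coord_neq0 (oner_neq0 B).
by move/eqP: (t0 i j); rewrite !mxE mulf_eq0 (negPf ci) (negPf cj).
Qed.

HB.instance Definition _ := GRing.Zmodule_isNzRing.Build AB
  tmulA tmul1l tmul1r tmulDl tmulDr tone_neq0.
HB.instance Definition _ := GRing.Lmodule_isLalgebra.Build k AB tmulZl.
HB.instance Definition _ := GRing.Lalgebra_isAlgebra.Build k AB tmulZr.
HB.instance Definition _ := Algebra_isFalgebra.Build k AB.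

Lemma tensM (a a' : A) (b b' : B) :
  (a ⊗ b) * (a' ⊗ b') = (a * a') ⊗ (b * b').
Proof. exact: tmul_tens. Qed.

Lemma tens11 : (1 : A) ⊗ (1 : B) = 1.
Proof. by []. Qed.

End TensorAlgebra.

(* tlift (fun a b => counit a *: b) is counit ⊗ id followed by k ⊗ C = C. *)
HB.mixin Record Vector_isCoalgebra (k : fieldType) C of Vector k C := {
  comul : 'Hom(C, (C ⊗ C)%type);
  counit : 'Hom(C, k^o);
  comulA : forall x : C,
    tassoc (tmap comul idfun (comul x)) = tmap idfun comul (comul x);
  counitl : forall x : C, tlift (fun a b => (counit a : k) *: b) (comul x) = x;
  counitr : forall x : C, tlift (fun a b => (counit b : k) *: a) (comul x) = x
}.
#[short(type="coalgType")]
HB.structure Definition Coalgebra (k : fieldType) :=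
  { C of Vector k C & Vector_isCoalgebra k C }.

HB.mixin Record isBialgebra (k : fieldType) H
    of Falgebra k H & Coalgebra k H := {
  comul1 : comul (1 : H) = 1;
  comulM : forall x y : H, comul (x * y) = comul x * comul y;
  counit1 : counit (1 : H) = 1;
  counitM : forall x y : H, counit (x * y) = counit x * counit y
}.
#[short(type="bialgType")]
HB.structure Definition Bialgebra (k : fieldType) :=
  { H of Falgebra k H & Coalgebra k H & isBialgebra k H }.

HB.mixin Record isHopfAlgebra (k : fieldType) H of Bialgebra k H := {
  antipode : 'Hom(H, H);
  antipodel : forall x : H,
    tlift (fun a b => antipode a * b) (comul x) = (counit x : k) *: 1;
  antipoder : forall x : H,
    tlift (fun a b => a * antipode b) (comul x) = (counit x : k) *: 1
}.
#[short(type="hopfType")]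
HB.structure Definition HopfAlgebra (k : fieldType) :=
  { H of Bialgebra k H & isHopfAlgebra k H }.

Section Dual.
Variables (k : fieldType).

Definition dual (V : vectType k) : Type := 'Hom(V, k^o).
HB.instance Definition _ (V : vectType k) :=
  Vector.copy (dual V) 'Hom(V, k^o).

Implicit Types (U V W : vectType k).

Definition dcoord V (i : 'I_(\dim {:V})) : dual V :=
  linfun (coord (vbasis {:V}) i : V -> k^o).

Lemma dcoordE V (i : 'I_(\dim {:V})) (v : V) :
  dcoord i v = coord (vbasis {:V}) i v.
Proof. by rewrite lfunE. Qed.

Lemma dual_sum V (f : dual V) :
  f = \sum_(i < \dim {:V}) f (vbasis {:V})`_i *: dcoord i.
Proof.
apply/lfunP => v; rewrite sum_lfunE [in LHS](coord_sum v) linear_sum.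
apply: eq_bigr => i _; rewrite linearZ scale_lfunE /= dcoordE.
exact: mulrC.
Qed.

Lemma mulr_tlift V W (c : k^o) (f : V -> W -> k^o) t :
  c * tlift f t = tlift (fun a b => c * f a b : k^o) t.
Proof. by rewrite -[LHS]/((c : k) *: tlift f t) -tliftZ. Qed.

Lemma addk_tlift V W (f g : V -> W -> k^o) t :
  (tlift f t : k) + tlift g t = tlift (fun a b => (f a b : k) + g a b : k^o) t.
Proof. by rewrite -[LHS]/(tlift f t + tlift g t : k^o) -tliftD. Qed.
Lemma mulk_tlift V W (c : k) (f : V -> W -> k^o) t :
  c * tlift f t = tlift (fun a b => c * f a b : k^o) t.
Proof. by rewrite -[LHS]/(c *: tlift f t) -tliftZ. Qed.

(* Contraction of the first tensorand with a vector. *)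
Definition contr V W (t : (dual V ⊗ W)%type) (v : V) : W :=
  tlift (fun (f : dual V) w => (f v : k) *: w) t.

Lemma contr_tens V W (f : dual V) (w : W) v :
  contr (f ⊗ w) v = (f v : k) *: w.
Proof.
rewrite /contr tlift_tens // => [y|x] c u u'.
  by rewrite add_lfunE scale_lfunE scalerDl -scalerA.
by rewrite scalerDr !scalerA mulrC.
Qed.

Lemma contr0 V W v : contr (0 : (dual V ⊗ W)%type) v = 0.
Proof. exact: linear0. Qed.
Lemma contrD V W (s t : (dual V ⊗ W)%type) v :
  contr (s + t) v = contr s v + contr t v.
Proof. exact: linearD. Qed.
Lemma contrZ V W c (t : (dual V ⊗ W)%type) v :
  contr (c *: t) v = c *: contr t v.
Proof. exact: linearZ. Qed.

Lemma contr_sum V W (t : (dual V ⊗ W)%type) :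
  t = \sum_(i < \dim {:V}) dcoord i ⊗ contr t (vbasis {:V})`_i.
Proof.
elim/tens_ind: t => [|s t hs ht|f w].
- by rewrite big1 // => i _; rewrite contr0 linear0.
- rewrite {1}hs {1}ht -big_split; apply: eq_bigr => i _ /=.
  by rewrite contrD tensDr.
rewrite {1}(dual_sum f) tens_suml; apply: eq_bigr => i _.
by rewrite contr_tens tensZl tensZr.
Qed.

Lemma contr_inj V W (s t : (dual V ⊗ W)%type) :
  (forall v, contr s v = contr t v) -> s = t.
Proof.
by move=> st; rewrite (contr_sum s) (contr_sum t); under eq_bigr do rewrite st.
Qed.

Lemma contr_linear V W (t : (dual V ⊗ W)%type) : linear (contr t).
Proof.
move=> c u v; rewrite /contr -tliftZ -tliftD; apply: eq_tlift => f w.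
by rewrite linearP scalerDl scalerA.
Qed.

(* The pairing of V^* ⊗ W^* with V ⊗ W, on pure tensors of V ⊗ W. *)
Definition pairing V W (t : (dual V ⊗ dual W)%type) (v : V) (w : W) : k :=
  (contr t v : dual W) w.

Lemma pairing_tens V W (f : dual V) (g : dual W) v w :
  pairing (f ⊗ g) v w = (f v : k) * (g w : k).
Proof. by rewrite /pairing contr_tens scale_lfunE. Qed.

Lemma pairing_inj V W (s t : (dual V ⊗ dual W)%type) :
  (forall v w, pairing s v w = pairing t v w) -> s = t.
Proof. by move=> st; apply: contr_inj => v; apply/lfunP => w; apply: st. Qed.

Lemma pairing0 V W v w : pairing (0 : (dual V ⊗ dual W)%type) v w = 0.
Proof. by rewrite /pairing contr0 zero_lfunE. Qed.
Lemma pairingD V W (s t : (dual V ⊗ dual W)%type) v w :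
  pairing (s + t) v w = pairing s v w + pairing t v w.
Proof. by rewrite /pairing contrD add_lfunE. Qed.
Lemma pairingZ V W c (t : (dual V ⊗ dual W)%type) v w :
  pairing (c *: t) v w = c * pairing t v w.
Proof. by rewrite /pairing contrZ scale_lfunE. Qed.
Lemma pairing_sum V W I (r : seq I) (F : I -> (dual V ⊗ dual W)%type) v w :
  pairing (\sum_(i <- r) F i) v w = \sum_(i <- r) pairing (F i) v w.
Proof.
apply: (big_morph (fun t => pairing t v w)) => [x y|];
  by rewrite ?pairingD ?pairing0.
Qed.

Lemma pairing_is_linearl V W (t : (dual V ⊗ dual W)%type) w :
  linear (fun v => pairing t v w : k^o).
Proof. by move=> c u v; rewrite /pairing contr_linear add_lfunE scale_lfunE. Qed.
Lemma pairing_is_linearr V W (t : (dual V ⊗ dual W)%type) v :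
  linear (pairing t v : W -> k^o).
Proof. by move=> c u w; rewrite /pairing linearP. Qed.

End Dual.

Section DualHopf.
Variables (k : fieldType) (H : hopfType k).
Local Notation D := (dual H).
Implicit Types (f g h : D).

Lemma mul_lfun_bilin f g :
  (forall b, linear ((fun a b => f a * g b : k^o)^~ b)) /\
  (forall a, linear ((fun a b => f a * g b : k^o) a)).
Proof.
split=> x c u v; rewrite linearP ?mulrDl ?mulrDr.
  by rewrite [X in X + _]/= -scalerAl.
by rewrite -scalerAr.
Qed.

(* (f * g)(x) = f(x_1) g(x_2), i.e. the transpose of the comultiplication. *)
Definition dual_mul f g : D :=
  linfun (tlift (fun a b => f a * g b : k^o) \o comul : H -> k^o).
Definition dual_one : D := counit.

Lemma dual_mulE f g x :
  dual_mul f g x = tlift (fun a b => f a * g b : k^o) (comul x).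
Proof. by rewrite lfunE. Qed.

Lemma dual_mulDl : left_distributive dual_mul +%R.
Proof.
move=> f g h; apply/lfunP => x; rewrite add_lfunE !dual_mulE -tliftD.
by apply: eq_tlift => a b; rewrite add_lfunE mulrDl.
Qed.
Lemma dual_mulDr : right_distributive dual_mul +%R.
Proof.
move=> f g h; apply/lfunP => x; rewrite add_lfunE !dual_mulE -tliftD.
by apply: eq_tlift => a b; rewrite add_lfunE mulrDr.
Qed.
Lemma dual_mulZl c f g : c *: dual_mul f g = dual_mul (c *: f) g.
Proof.
apply/lfunP => x; rewrite scale_lfunE !dual_mulE -tliftZ.
by apply: eq_tlift => a b; rewrite scale_lfunE scalerAl.
Qed.
Lemma dual_mulZr c f g : c *: dual_mul f g = dual_mul f (c *: g).
Proof.
apply/lfunP => x; rewrite scale_lfunE !dual_mulE -tliftZ.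
by apply: eq_tlift => a b; rewrite scale_lfunE scalerAr.
Qed.

Lemma dual_mulA : associative dual_mul.
Proof.
move=> f g h; apply/lfunP => x; rewrite !dual_mulE.
pose F (a : H) (t : (H ⊗ H)%type) : k^o :=
  f a * tlift (fun b c => g b * h c : k^o) t.
have Fl t : linear (F^~ t).
  by move=> c u v; rewrite /F linearP mulrDl -scalerAl.
have Fr a : linear (F a).
  by move=> c u v; rewrite /F linearP mulrDr -scalerAr.
have -> : tlift (fun a b => f a * dual_mul g h b : k^o) (comul x) =
          tlift F (tmap idfun comul (comul x)).
  rewrite /tmap tlift_tlift; apply: eq_tlift => a b.
  by rewrite tlift_tens // dual_mulE.
rewrite -comulA.
transitivity
  (tlift (fun t c => tlift (fun a b => f a * g b : k^o) t * h c : k^o)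
         (tmap comul idfun (comul x))); last first.
  rewrite /tmap tlift_tlift; apply: eq_tlift => a b.
  rewrite tlift_tens ?dual_mulE // => [y|y] c u v.
    by rewrite linearP mulrDl -scalerAl.
  by rewrite linearP mulrDr -scalerAr.
rewrite /tassoc tlift_tlift; apply: eq_tlift => t c.
rewrite tlift_tlift [RHS]mulrC.
rewrite [RHS]mulr_tlift.
apply: eq_tlift => a b; rewrite tlift_tens // /F tlift_tens.
- by rewrite [RHS]mulrC mulrA.
- exact: (mul_lfun_bilin g h).1.
- exact: (mul_lfun_bilin g h).2.
Qed.

Lemma dual_mul1l : left_id dual_one dual_mul.
Proof.
move=> f; apply/lfunP => x; rewrite dual_mulE -{2}(counitl x) linear_tlift.
by apply: eq_tlift => a b; rewrite linearZ.
Qed.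
Lemma dual_mul1r : right_id dual_one dual_mul.
Proof.
move=> f; apply/lfunP => x; rewrite dual_mulE -{2}(counitr x) linear_tlift.
by apply: eq_tlift => a b; rewrite linearZ mulrC.
Qed.
Lemma dual_one_neq0 : dual_one != 0.
Proof.
apply/eqP => /lfunP/(_ 1)/eqP; rewrite zero_lfunE /dual_one counit1.
by rewrite oner_eq0.
Qed.

HB.instance Definition _ := GRing.Zmodule_isNzRing.Build D
  dual_mulA dual_mul1l dual_mul1r dual_mulDl dual_mulDr dual_one_neq0.
HB.instance Definition _ := GRing.Lmodule_isLalgebra.Build k D dual_mulZl.
HB.instance Definition _ := GRing.Lalgebra_isAlgebra.Build k D dual_mulZr.
HB.instance Definition _ := Algebra_isFalgebra.Build k D.

Lemma dualM f g x : (f * g) x = tlift (fun a b => f a * g b : k^o) (comul x).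
Proof. exact: dual_mulE. Qed.
Lemma dual1 x : (1 : D) x = counit x. Proof. by []. Qed.

(* The transpose of the multiplication, see [dual_comulE]. *)
Definition dual_comul_fun f : (D ⊗ D)%type :=
  \sum_(i < \dim {:H}) \sum_(j < \dim {:H})
    f ((vbasis {:H})`_i * (vbasis {:H})`_j) *: (dcoord i ⊗ dcoord j).
Lemma dual_comul_is_linear : linear dual_comul_fun.
Proof.
move=> c f g; rewrite /dual_comul_fun scaler_sumr -big_split.
apply: eq_bigr => i _; rewrite scaler_sumr -big_split.
apply: eq_bigr => j _ /=.
by rewrite add_lfunE scale_lfunE scalerDl scalerA.
Qed.
HB.instance Definition _ := GRing.isLinear.Build k D (D ⊗ D)%type _
  dual_comul_fun dual_comul_is_linear.
Definition dual_comul : 'Hom(D, (D ⊗ D)%type) := linfun dual_comul_fun.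

Lemma dual_comulE f a b : pairing (dual_comul f) a b = f (a * b).
Proof.
rewrite lfunE /= /dual_comul_fun pairing_sum.
rewrite [in RHS](coord_sum a) mulr_suml linear_sum; apply: eq_bigr => i _.
rewrite pairing_sum [in RHS](coord_sum b) mulr_sumr linear_sum.
apply: eq_bigr => j _; rewrite pairingZ pairing_tens !dcoordE.
rewrite -scalerAl -scalerAr linearZ [in RHS]linearZ mulrC -mulrA; exact: erefl.
Qed.

Definition dual_counit_fun f : k^o := f (1 : H).
Lemma dual_counit_is_linear : linear dual_counit_fun.
Proof.
by move=> c f g; rewrite /dual_counit_fun add_lfunE scale_lfunE.
Qed.
HB.instance Definition _ := GRing.isLinear.Build k D k^o _
  dual_counit_fun dual_counit_is_linear.
Definition dual_counit : 'Hom(D, k^o) := linfun dual_counit_fun.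
Lemma dual_counitE f : dual_counit f = f 1. Proof. by rewrite lfunE. Qed.

Definition dual_antipode_fun f : D := (f \o antipode)%VF.
Lemma dual_antipode_is_linear : linear dual_antipode_fun.
Proof.
move=> c f g; apply/lfunP => x.
by rewrite !(comp_lfunE, add_lfunE, scale_lfunE).
Qed.
HB.instance Definition _ := GRing.isLinear.Build k D D _
  dual_antipode_fun dual_antipode_is_linear.
Definition dual_antipode : 'Hom(D, D) := linfun dual_antipode_fun.
Lemma dual_antipodeE f x : (dual_antipode f : D) x = f (antipode x).
Proof. by rewrite lfunE /= comp_lfunE. Qed.

Lemma contr_dual_comul f a b : (contr (dual_comul f) a : D) b = f (a * b).
Proof. exact: dual_comulE. Qed.

Lemma dual_comulA f :
  tassoc (tmap dual_comul idfun (dual_comul f)) =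
  tmap idfun dual_comul (dual_comul f).
Proof.
apply: contr_inj => a; apply: pairing_inj => b c.
have -> : pairing (contr (tmap idfun dual_comul (dual_comul f)) a) b c
          = f (a * (b * c)).
  rewrite -dual_comulE; elim/tens_ind: (dual_comul f) => [|s t hs ht|g h].
  - by rewrite !linear0 !contr0 ?linear0 ?contr0 !pairing0.
  - by move: hs ht; rewrite !linearD !contrD !pairingD => -> ->.
  by rewrite tmap_tens /= contr_tens pairingZ dual_comulE pairing_tens.
rewrite mulrA -dual_comulE; elim/tens_ind: (dual_comul f) => [|s t hs ht|g h].
- by rewrite !linear0 !contr0 ?linear0 ?contr0 !pairing0.
- by move: hs ht; rewrite !linearD !contrD !pairingD => -> ->.
rewrite tmap_tens /= pairing_tens -dual_comulE.
elim/tens_ind: (dual_comul g) => [|s t hs ht|g1 g2].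
- by rewrite tens0l !linear0 !contr0 ?linear0 ?contr0 !pairing0 mul0r.
- by move: hs ht; rewrite tensDl !linearD !contrD !pairingD mulrDl => -> ->.
by rewrite tassoc_tens contr_tens pairingZ !pairing_tens mulrA.
Qed.

Lemma dual_counitl f :
  tlift (fun g h : D => (dual_counit g : k) *: h) (dual_comul f) = f.
Proof.
apply/lfunP => x; rewrite -{2}(mul1r x) -dual_comulE.
elim/tens_ind: (dual_comul f) => [|s t hs ht|g h].
- by rewrite linear0 pairing0 zero_lfunE.
- by rewrite linearD add_lfunE hs ht pairingD.
rewrite -/(contr _ _) pairing_tens tlift_tens.
- by rewrite scale_lfunE dual_counitE.
- by move=> y c u v; rewrite linearP scalerDl -scalerA.
- by move=> y c u v; rewrite scalerDr !scalerA mulrC.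
Qed.

Lemma dual_counitr f :
  tlift (fun g h : D => (dual_counit h : k) *: g) (dual_comul f) = f.
Proof.
apply/lfunP => x; rewrite -{2}(mulr1 x) -dual_comulE.
elim/tens_ind: (dual_comul f) => [|s t hs ht|g h].
- by rewrite linear0 pairing0 zero_lfunE.
- by rewrite linearD add_lfunE hs ht pairingD.
rewrite pairing_tens tlift_tens.
- by rewrite scale_lfunE dual_counitE mulrC.
- by move=> y c u v; rewrite scalerDr !scalerA mulrC.
- by move=> y c u v; rewrite linearP scalerDl -scalerA.
Qed.

HB.instance Definition _ := Vector_isCoalgebra.Build k D
  dual_comulA dual_counitl dual_counitr.

Lemma dual_comul1 : comul (1 : D) = 1.
Proof.
apply: pairing_inj => a b; rewrite dual_comulE -tens11 pairing_tens !dual1.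
exact: counitM.
Qed.

Lemma pairing_bilin (s : (D ⊗ D)%type) :
  (forall b, linear ((fun a b => pairing s a b : k^o)^~ b)) /\
  (forall a, linear ((fun a b => pairing s a b : k^o) a)).
Proof.
by split=> x; [exact: pairing_is_linearl | exact: pairing_is_linearr].
Qed.

Lemma pairingM (s t : (D ⊗ D)%type) a b :
  pairing (s * t) a b =
  tlift (fun a1 a2 => tlift (fun b1 b2 =>
    pairing s a1 b1 * pairing t a2 b2 : k^o) (comul b)) (comul a).
Proof.
elim/tens_ind: s => [|s s' hs hs'|f f'].
- rewrite mul0r pairing0; symmetry.
  apply: (@tlift_eq0 _ _ _ k^o) => a1 a2; apply: (@tlift_eq0 _ _ _ k^o) => b1 b2.
  by rewrite pairing0 mul0r.
- rewrite mulrDl pairingD hs hs' addk_tlift; apply: (@eq_tlift _ _ _ k^o) => a1 a2.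
  rewrite addk_tlift; apply: (@eq_tlift _ _ _ k^o) => b1 b2.
  by rewrite pairingD mulrDl.
elim/tens_ind: t => [|t t' ht ht'|g g'].
- rewrite mulr0 pairing0; symmetry.
  apply: (@tlift_eq0 _ _ _ k^o) => a1 a2; apply: (@tlift_eq0 _ _ _ k^o) => b1 b2.
  by rewrite pairing0 mulr0.
- rewrite mulrDr pairingD ht ht' addk_tlift; apply: (@eq_tlift _ _ _ k^o) => a1 a2.
  rewrite addk_tlift; apply: (@eq_tlift _ _ _ k^o) => b1 b2.
  by rewrite pairingD mulrDr.
rewrite tensM pairing_tens !dualM mulrC.
rewrite [LHS]mulk_tlift; apply: (@eq_tlift _ _ _ k^o) => a1 a2.
rewrite mulrC; rewrite [LHS]mulk_tlift; apply: (@eq_tlift _ _ _ k^o) => b1 b2.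
by rewrite !pairing_tens mulrACA.
Qed.

Lemma dual_comulM f g : comul (f * g) = comul f * comul g.
Proof.
apply: pairing_inj => a b; rewrite dual_comulE pairingM dualM comulM.
have -> (s t : (H ⊗ H)%type) : s * t = tmul s t by [].
rewrite /tmul tlift_tlift; apply: (@eq_tlift _ _ _ k^o) => a1 a2.
rewrite tlift_tlift; apply: (@eq_tlift _ _ _ k^o) => b1 b2.
rewrite tlift_tens ?dual_comulE //.
  exact: (mul_lfun_bilin f g).1.
exact: (mul_lfun_bilin f g).2.
Qed.

Lemma dual_counit1 : counit (1 : D) = 1.
Proof. by rewrite dual_counitE dual1 counit1. Qed.
Lemma dual_counitM f g : counit (f * g) = counit f * counit g.
Proof.
rewrite !dual_counitE dualM comul1 -tens11 tlift_tens //.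
  exact: (mul_lfun_bilin f g).1.
exact: (mul_lfun_bilin f g).2.
Qed.

HB.instance Definition _ := isBialgebra.Build k D
  dual_comul1 dual_comulM dual_counit1 dual_counitM.

Lemma dual_antipodel f :
  tlift (fun g h : D => dual_antipode g * h) (comul f) = counit f *: 1.
Proof.
apply/lfunP => x; rewrite scale_lfunE dual1 dual_counitE.
have -> : (f 1 : k) *: counit x = f ((counit x : k) *: (1 : H)).
  by rewrite linearZ; exact: mulrC.
rewrite -antipodel [RHS]linear_tlift /=.
under [RHS]eq_tlift do rewrite -dual_comulE.
elim/tens_ind: (comul f) => [|s t hs ht|g h].
- rewrite linear0 zero_lfunE; symmetry.
  by apply: (@tlift_eq0 _ _ _ k^o) => a b; rewrite pairing0.
- rewrite linearD add_lfunE hs ht -tliftD.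
  by apply: (@eq_tlift _ _ _ k^o) => a b; rewrite pairingD.
rewrite tlift_tens => [|y c u v|y c u v].
- rewrite dualM; apply: (@eq_tlift _ _ _ k^o) => a b.
  by rewrite pairing_tens dual_antipodeE.
- by rewrite linearP mulrDl -scalerAl.
- by rewrite mulrDr -scalerAr.
Qed.

Lemma dual_antipoder f :
  tlift (fun g h : D => g * dual_antipode h) (comul f) = counit f *: 1.
Proof.
apply/lfunP => x; rewrite scale_lfunE dual1 dual_counitE.
have -> : (f 1 : k) *: counit x = f ((counit x : k) *: (1 : H)).
  by rewrite linearZ; exact: mulrC.
rewrite -antipoder [RHS]linear_tlift /=.
under [RHS]eq_tlift do rewrite -dual_comulE.
elim/tens_ind: (comul f) => [|s t hs ht|g h].
- rewrite linear0 zero_lfunE; symmetry.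
  by apply: (@tlift_eq0 _ _ _ k^o) => a b; rewrite pairing0.
- rewrite linearD add_lfunE hs ht -tliftD.
  by apply: (@eq_tlift _ _ _ k^o) => a b; rewrite pairingD.
rewrite tlift_tens => [|y c u v|y c u v].
- rewrite dualM; apply: (@eq_tlift _ _ _ k^o) => a b.
  by rewrite pairing_tens dual_antipodeE.
- by rewrite mulrDl -scalerAl.
- by rewrite linearP mulrDr -scalerAr.
Qed.

HB.instance Definition _ := isHopfAlgebra.Build k D
  dual_antipodel dual_antipoder.

End DualHopf.

(* An affine group scheme is given by its commutative coordinate Hopf algebra;
   finiteness is built into [hopfType], whose objects are finite dimensional. *)
Record finGroupScheme (k : fieldType) := FinGroupScheme {
  coord_ring : hopfType k;
  coord_ring_comm : commutative (@GRing.mul coord_ring)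
}.

Definition group_algebra (k : fieldType) (G : finGroupScheme k) : hopfType k :=
  dual (coord_ring G).

Lemma group_algebra_cocommutative (k : fieldType) (G : finGroupScheme k)
  (b : group_algebra G) : tswap (comul b) = comul b.
Proof.
apply: pairing_inj => x y; rewrite [RHS]dual_comulE coord_ring_comm.
rewrite -dual_comulE; elim/tens_ind: (comul b) => [|s t hs ht|g h].
- by rewrite linear0 !pairing0.
- by rewrite linearD !pairingD hs ht.
by rewrite tswap_tens !pairing_tens mulrC.
Qed.

(* Tensors are associated to the right: the cocycle identity is stated in
   B ⊗ (B ⊗ B). *)
Record twist (k : fieldType) (B : hopfType k) := Twist {
  twist_val :> (B ⊗ B)%type;
  twist_unit : twist_val \is a GRing.unit;
  twist_cocycle :
    tassoc (tmap comul idfun twist_val * (twist_val ⊗ (1 : B))) =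
    tmap idfun comul twist_val * ((1 : B) ⊗ twist_val);
  twist_counitl : tlift (fun a b : B => (counit a : k) *: b) twist_val = 1;
  twist_counitr : tlift (fun a b : B => (counit b : k) *: a) twist_val = 1
}.

Section TensorMorphisms.
Variable (k : fieldType).

Lemma tmapM (A B C D : falgType k) (f : {linear A -> C}) (g : {linear B -> D})
    (s t : (A ⊗ B)%type) :
  {morph f : x y / x * y} -> {morph g : x y / x * y} ->
  tmap f g (s * t) = tmap f g s * tmap f g t.
Proof.
move=> fM gM; elim/tens_ind: s => [|s s' hs hs'|a b].
- by rewrite mul0r linear0 mul0r.
- by rewrite mulrDl !linearD /= hs hs' mulrDl.
elim/tens_ind: t => [|t t' ht ht'|a' b'].
- by rewrite mulr0 linear0 mulr0.
- by rewrite mulrDr !linearD /= ht ht' mulrDr.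
by rewrite tensM !tmap_tens tensM fM gM.
Qed.

Lemma tassocM (A B C : falgType k) (s t : ((A ⊗ B) ⊗ C)%type) :
  tassoc (s * t) = tassoc s * tassoc t.
Proof.
elim/tens_ind: s => [|s s' hs hs'|u c].
- by rewrite mul0r linear0 mul0r.
- by rewrite mulrDl !linearD /= hs hs' mulrDl.
elim/tens_ind: t => [|t t' ht ht'|v c'].
- by rewrite mulr0 linear0 mulr0.
- by rewrite mulrDr !linearD /= ht ht' mulrDr.
rewrite tensM; elim/tens_ind: u => [|u u' hu hu'|a b].
- by rewrite mul0r !tens0l linear0 mul0r.
- by rewrite mulrDl !tensDl !linearD /= hu hu' mulrDl.
elim/tens_ind: v => [|v v' hv hv'|a' b'].
- by rewrite mulr0 !tens0l linear0 mulr0.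
- by rewrite mulrDr !tensDl !linearD /= hv hv' mulrDr.
by rewrite tensM !tassoc_tens !tensM.
Qed.

End TensorMorphisms.

(* The coalgebra B_J: an alias of B that carries the comultiplication
   b |-> comul b * J, see [twisted_comulE], and the counit of B. *)
Definition twisted_coalgebra (k : fieldType) (B : hopfType k) (J : twist B) :
  Type := B.

Section TwistedCoalgebra.
Variables (k : fieldType) (B : hopfType k) (J : twist B).

Local Notation BJ := (twisted_coalgebra J).
HB.instance Definition _ := Vector.copy BJ B.

Definition twisted_comul_fun (b : B) : (B ⊗ B)%type := comul b * twist_val J.
Lemma twisted_comul_is_linear : linear twisted_comul_fun.
Proof.
by move=> c x y; rewrite /twisted_comul_fun linearP mulrDl scalerAl.
Qed.
HB.instance Definition _ := GRing.isLinear.Build k B (B ⊗ B)%type _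
  twisted_comul_fun twisted_comul_is_linear.
Definition twisted_comul : 'Hom(B, (B ⊗ B)%type) := linfun twisted_comul_fun.

Lemma twisted_comulE b : twisted_comul b = comul b * twist_val J.
Proof. by rewrite lfunE. Qed.

Lemma twisted_comulA (b : B) :
  tassoc (tmap twisted_comul idfun (twisted_comul b)) =
  tmap idfun twisted_comul (twisted_comul b).
Proof.
have Hl t : tmap twisted_comul idfun t =
            tmap comul idfun t * (twist_val J ⊗ (1 : B)).
  elim/tens_ind: t => [|s t hs ht|x y].
  - by rewrite !linear0 mul0r.
  - by rewrite !linearD /= hs ht mulrDl.
  by rewrite !tmap_tens /= twisted_comulE tensM mulr1.
have Hr t : tmap idfun twisted_comul t =
            tmap idfun comul t * ((1 : B) ⊗ twist_val J).
  elim/tens_ind: t => [|s t hs ht|x y].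
  - by rewrite !linear0 mul0r.
  - by rewrite !linearD /= hs ht mulrDl.
  by rewrite !tmap_tens /= twisted_comulE tensM mulr1.
rewrite Hl Hr twisted_comulE !tmapM //; try exact: comulM.
by rewrite -mulrA tassocM comulA twist_cocycle mulrA.
Qed.

Lemma counitlM (s t : (B ⊗ B)%type) :
  tlift (fun a b : B => (counit a : k) *: b) (s * t) =
  tlift (fun a b : B => (counit a : k) *: b) s *
  tlift (fun a b : B => (counit a : k) *: b) t.
Proof.
have E (a b : B) : tlift (fun a b : B => (counit a : k) *: b) (a ⊗ b) =
                   (counit a : k) *: b.
  rewrite tlift_tens // => y c u v; last by rewrite scalerDr !scalerA mulrC.
  by rewrite linearP scalerDl -scalerA.
elim/tens_ind: s => [|s s' hs hs'|a b].
- by rewrite mul0r linear0 mul0r.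
- by rewrite mulrDl !linearD /= hs hs' mulrDl.
elim/tens_ind: t => [|t t' ht ht'|a' b'].
- by rewrite mulr0 linear0 mulr0.
- by rewrite mulrDr !linearD /= ht ht' mulrDr.
by rewrite tensM !E counitM -scalerAl -scalerAr scalerA.
Qed.

Lemma counitrM (s t : (B ⊗ B)%type) :
  tlift (fun a b : B => (counit b : k) *: a) (s * t) =
  tlift (fun a b : B => (counit b : k) *: a) s *
  tlift (fun a b : B => (counit b : k) *: a) t.
Proof.
have E (a b : B) : tlift (fun a b : B => (counit b : k) *: a) (a ⊗ b) =
                   (counit b : k) *: a.
  rewrite tlift_tens // => y c u v; first by rewrite scalerDr !scalerA mulrC.
  by rewrite linearP scalerDl -scalerA.
elim/tens_ind: s => [|s s' hs hs'|a b].
- by rewrite mul0r linear0 mul0r.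
- by rewrite mulrDl !linearD /= hs hs' mulrDl.
elim/tens_ind: t => [|t t' ht ht'|a' b'].
- by rewrite mulr0 linear0 mulr0.
- by rewrite mulrDr !linearD /= ht ht' mulrDr.
by rewrite tensM !E counitM -scalerAl -scalerAr scalerA.
Qed.

Lemma twisted_counitl (b : B) :
  tlift (fun x y : B => (counit x : k) *: y) (twisted_comul b) = b.
Proof. by rewrite twisted_comulE counitlM counitl twist_counitl mulr1. Qed.
Lemma twisted_counitr (b : B) :
  tlift (fun x y : B => (counit y : k) *: x) (twisted_comul b) = b.
Proof. by rewrite twisted_comulE counitrM counitr twist_counitr mulr1. Qed.

HB.instance Definition _ := Vector_isCoalgebra.Build k BJ
  twisted_comulA twisted_counitl twisted_counitr.

End TwistedCoalgebra.

Section MinimalNondegenerate.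
Variables (k : fieldType).

(* The image of V ⊗ W in A ⊗ B. *)
Definition tensv (A B : vectType k) (V : {vspace A}) (W : {vspace B}) :
    {vspace (A ⊗ B)%type} :=
  <<[seq v ⊗ w | v <- vbasis V, w <- vbasis W]>>%VS.

Definition subcoalgebra (C : coalgType k) (V : {vspace C}) : Prop :=
  forall v, v \in V -> comul v \in tensv V V.

Definition simple_coalgebra (C : coalgType k) : Prop :=
  ({:C} != 0)%VS /\
  forall V : {vspace C}, subcoalgebra V -> V = 0%VS \/ V = fullv.

Definition nondegenerate_twist (B : hopfType k) (J : twist B) : Prop :=
  simple_coalgebra (twisted_coalgebra J).

Definition left_contraction (A B : vectType k) (R : (A ⊗ B)%type)
    (f : dual B) : A :=
  tlift (fun a b => (f b : k) *: a) R.

Lemma left_contraction_is_linear (A B : vectType k) (R : (A ⊗ B)%type) :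
  linear (left_contraction R).
Proof.
move=> c f g; rewrite /left_contraction -tliftZ -tliftD; apply: eq_tlift => a b.
by rewrite add_lfunE scale_lfunE scalerDl -scalerA.
Qed.
HB.instance Definition _ (A B : vectType k) (R : (A ⊗ B)%type) :=
  GRing.isLinear.Build k (dual B) A _ (left_contraction R)
    (left_contraction_is_linear R).

(* The space of left tensorands (id ⊗ f)(R) of R, for f in the dual of B. *)
Definition left_tensorands (A B : vectType k) (R : (A ⊗ B)%type) : {vspace A} :=
  limg (linfun (left_contraction R)).

(* The R-matrix of the triangular Hopf algebra B^J. *)
Definition twist_rmatrix (B : hopfType k) (J : twist B) : (B ⊗ B)%type :=
  (tswap (twist_val J))^-1 * twist_val J.

(* B^J has the same underlying algebra, hence the same underlying space, as B,
   and minimality depends only on the R-matrix. *)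
Definition minimal_twist (B : hopfType k) (J : twist B) : Prop :=
  left_tensorands (twist_rmatrix J) = fullv.

End MinimalNondegenerate.

(* Main.v *)
Require Import Defs.
From HB Require Import structures.
From mathcomp Require Import all_boot all_order all_algebra all_field.

(** Write B for the cocommutative Hopf algebra, J for the twist, R for its
    R-matrix, and S for the algebra dual to the coalgebra B_J, that is, the
    functionals on B with (f * g)(x) = (f ⊗ g)(Delta(x) J).  Right translation
    (b . f)(x) = f(x b) makes B act on S.  The proof turns both properties of J into
    statements about the two-sided multiplications f |-> sum_j h_j * f * g_j.

    Two facts connect them.  Since B is cocommutative,
    Delta(x) J = (Delta(x) J)_21 R, so S is commutative up to the braiding R:
    f * g = sum_R (R_2 . g) * (R_1 . f) ([braided_commutative]).  And the Galois
    map c ⊗ b |-> Delta(c) J (1 ⊗ b) of B ⊗ B is bijective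
    ([galois_map_surjective]); dually, for each functional phi on B there is a
    tensor sum_j h_j ⊗ g_j, depending injectively on phi, such that
    sum_j h_j * (b . g_j) = phi(b) 1 for all b.  Together they give
    [translate_two_sided]: sum_j h_j * f * g_j is the translate of f by the left
    tensorand (id ⊗ phi)(R).

    If J is minimal, every element of B is such a left tensorand, so all
    translations are two-sided multiplications and hence preserve two-sided
    ideals of S.  Dually, each subcoalgebra V of B_J is a right ideal of B.  Then
    Delta(V) lies in V ⊗ B, and applying v_1 antipode(v_2) = eps(v) 1 to some v
    in V with eps(v) nonzero puts 1 in V.  So B_J is simple
    ([minimal_nondegenerate]).

    If B_J is simple, then S is a finite dimensional simple algebra over an
    algebraically closed field, so S is central, and a two-sided multiplication
    vanishes only if its tensor does ([two_sided_mul_free]).  Hence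
    (id ⊗ phi)(R) = 0 forces phi = 0: the left tensorands of R form a space of
    the dimension of B ([nondegenerate_minimal]). *)

Set Implicit Arguments.
Unset Strict Implicit.
Unset Printing Implicit Defensive.

Import GRing.Theory passmx.
Local Open Scope ring_scope.
Local Open Scope tensor_scope.

(** * Central simple algebras over an algebraically closed field *)

Lemma tlift_sumf (k : fieldType) (A B C : vectType k) I (r : seq I)
    (F : I -> A -> B -> C) t :
  \sum_(i <- r) tlift (F i) t = tlift (fun a b => \sum_(i <- r) F i a b) t.
Proof.
elim: r => [|i r IH].
  by rewrite big_nil tlift_eq0 // => a b; rewrite big_nil.
by rewrite big_cons IH -tliftD; apply: eq_tlift => a b; rewrite big_cons.
Qed.

Section CentralSimple.
Variables (k : closedFieldType) (S : falgType k).

(** Stated as 1 being in the two-sided ideal generated by h, because all uses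
    take a presentation of 1 as a sum of terms a * h * b. *)
Definition simple_algebra : Prop :=
  forall h : S, h != 0 ->
    exists t : (S ⊗ S)%type, tlift (fun a b => a * h * b) t = 1.

Lemma eigenvector_exists (f : 'End(S)) :
  exists c : k, exists2 x : S, x != 0 & f x = c *: x.
Proof.
have d0 : (0 < \dim {:S})%N.
  by rewrite lt0n dimv_eq0; apply/eqP => S0; have := memvf (1 : S);
    rewrite S0 memv0 oner_eq0.
pose M := mxof (vbasis {:S}) (vbasis {:S}) f.
have /closed_rootP[c] : size (char_poly M) != 1%N.
  by rewrite size_char_poly; case: (\dim _) d0.
rewrite -eigenvalue_root_char /eigenvalue => fc; exists c.
have : leigenspace f c != 0%VS.
  by rewrite (leigenspaceE (vbasisP {:S})) vsof_eq0 // vbasisP.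
rewrite -vpick0 => x0; exists (vpick (leigenspace f c)) => //.
have := memv_pick (leigenspace f c); rewrite memv_ker => /eqP.
rewrite add_lfunE opp_lfunE scale_lfunE id_lfunE => /eqP.
by rewrite subr_eq0 => /eqP.
Qed.

Hypothesis S_simple : simple_algebra.

(** For an eigenvalue c of multiplication by z, the central element z - c kills
    a nonzero x; were z - c nonzero, the ideal it generates would contain 1,
    which would then kill x too. *)
Lemma central_scalar (z : S) : (forall a, a * z = z * a) ->
  exists c : k, z = c *: 1.
Proof.
move=> zC; have [c [x x0]] := eigenvector_exists (amull z).
rewrite lfunE /= => zx; exists c; apply/eqP; rewrite -subr_eq0.
apply: contraNT x0 => /S_simple[t t1]; rewrite -[x]mul1r -t1.
have wC b : (z - c *: 1) * b = b * (z - c *: 1).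
  by rewrite mulrBl mulrBr zC -scalerAl -scalerAr mul1r mulr1.
rewrite [_ * x](linear_tlift (x \o* idfun)) tlift_eq0 // => a b /=.
rewrite -mulrA -mulrA mulrA wC -!mulrA mulrBl zx -scalerAl mul1r subrr.
by rewrite !mulr0.
Qed.

(** The map S ⊗ S -> End(S) sending h ⊗ g to f |-> h * f * g is injective, by
    induction on the number of terms: by simplicity a nonzero coefficient h_0
    can be replaced by 1, and then the commutators of the coefficients with any
    a satisfy a shorter relation.  So the coefficients are central, hence
    scalars, and f = 1 gives a linear relation between the g_i. *)
Lemma two_sided_mul_free m (g h : 'I_m -> S) :
    (forall c : 'I_m -> k, \sum_i c i *: g i = 0 -> c =1 fun=> 0) ->
    (forall f, \sum_i h i * f * g i = 0) ->
  h =1 fun=> 0.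
Proof.
elim: m => [|m IH] in g h *; first by move=> _ _ [].
move=> g_free hg.
have g_free' (c : 'I_m -> k) :
    \sum_i c i *: g (lift ord0 i) = 0 -> c =1 fun=> 0.
  pose c' j := oapp c 0 (unlift ord0 j).
  move=> c0 i; suff /(_ (lift ord0 i)) : c' =1 fun=> 0 by rewrite /c' liftK.
  apply: g_free; rewrite big_ord_recl /c' unlift_none scale0r add0r -[RHS]c0.
  by apply: eq_bigr => j _; rewrite liftK.
have [h0|h0] := eqVneq (h ord0) 0.
  move=> i; case: (unliftP ord0 i) => [j ->|-> //].
  apply: (IH _ (fun j => h (lift ord0 j)) g_free') => f.
  by have := hg f; rewrite big_ord_recl h0 !mul0r add0r.
have [t t1] := S_simple h0.
(* The relation stays true under h_i |-> sum a * h_i * b, and the new leading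
   coefficient is 1. *)
pose h' i := tlift (fun a b => a * h i * b) t.
have hg' f : \sum_i h' i * f * g i = 0.
  transitivity (tlift (fun a b => \sum_i a * (h i * (b * f) * g i)) t).
    rewrite -tlift_sumf; apply: eq_bigr => i _.
    rewrite -mulrA [LHS](linear_tlift ((f * g i) \o* idfun)).
    by apply: eq_tlift => a b /=; rewrite !mulrA.
  by apply: tlift_eq0 => a b; rewrite -mulr_sumr hg mulr0.
have h'C i a : a * h' i = h' i * a.
  case: (unliftP ord0 i) => [j ->|->]; last by rewrite /h' t1 mulr1 mul1r.
  apply/eqP; rewrite -subr_eq0; apply/eqP; move: j.
  pose com j := a * h' (lift ord0 j) - h' (lift ord0 j) * a.
  apply: (IH _ com g_free') => f.
  have := congr2 (fun x y => a * x - y) (hg' f) (hg' (a * f)).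
  rewrite mulr0 subr0 mulr_sumr -sumrB big_ord_recl.
  rewrite /h' t1 !mul1r mulrA subrr add0r => E.
  by rewrite -[RHS]E; apply: eq_bigr => j _; rewrite !mulrBl !mulrA.
have [c hc] : exists c : 'I_m.+1 -> k, forall i, h' i = c i *: 1.
  apply: (@fin_all_exists _ (fun=> k) (fun i c => h' i = c *: 1)) => i.
  exact/central_scalar/h'C.
have c0 : c ord0 = 0.
  apply: g_free; rewrite -[RHS](hg' 1); apply: eq_bigr => i _.
  by rewrite hc mulr1 -scalerAl mul1r.
by have /eqP := hc ord0; rewrite /h' t1 c0 scale0r oner_eq0.
Qed.
End CentralSimple.

(** * Functionals on tensors *)

Section TensorFunctionals.
Variable k : fieldType.
Implicit Types A B C D : vectType k.


Definition tens_dual A B (f : dual A) (g : dual B) : dual (A ⊗ B)%type :=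
  linfun (tlift (fun a b => f a * g b : k^o)).

Lemma tens_dual_pure A B (f : dual A) (g : dual B) a b :
  tens_dual f g (a ⊗ b) = (f a : k) * g b.
Proof.
rewrite lfunE /= tlift_tens // => x c u v; rewrite linearP ?mulrDl ?mulrDr.
  by rewrite [X in X + _]/= -scalerAl.
by rewrite -scalerAr.
Qed.

Lemma tens_dual0l A B (g : dual B) (t : (A ⊗ B)%type) : tens_dual 0 g t = 0.
Proof.
by rewrite lfunE /= tlift_eq0 // => a b; rewrite zero_lfunE mul0r.
Qed.

Lemma tens_dual_inj A B (s t : (A ⊗ B)%type) :
  (forall f g, tens_dual f g s = tens_dual f g t) -> s = t.
Proof.
suff E i j (r : (A ⊗ B)%type) : tens_dual (dcoord i) (dcoord j) r = r i j.
  by move=> st; apply/matrixP => i j; rewrite -!E st.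
pose cij (r : (A ⊗ B)%type) : k^o := r i j.
have cl : linear cij by move=> c u v; rewrite /cij !mxE.
pose cL : {linear (A ⊗ B)%type -> k^o} :=
  HB.pack cij (GRing.isLinear.Build k _ k^o _ cij cl).
apply: (tens_ext (f := tens_dual (dcoord i) (dcoord j)) (g := cL)) => a b.
by rewrite /= tens_dual_pure !dcoordE /cij mxE.
Qed.

Lemma tens_dual_map A B C D (u : {linear A -> C}) (v : {linear B -> D})
    (f : dual C) (g : dual D) (f' : dual A) (g' : dual B) t :
    (forall a, f (u a) = f' a) -> (forall b, g (v b) = g' b) ->
  tens_dual f g (tmap u v t) = tens_dual f' g' t.
Proof.
move=> fu gv.
apply: (tens_ext (f := tens_dual f g \o tmap u v)
  (g := tens_dual f' g')) => a b.
by rewrite /= tmap_tens !tens_dual_pure fu gv.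
Qed.

Lemma tens_dual_swap A B (f : dual A) (g : dual B) t :
  tens_dual g f (tswap t) = tens_dual f g t.
Proof.
apply: (tens_ext (f := tens_dual g f \o @tswap k A B)
  (g := tens_dual f g)) => a b.
by rewrite /= tswap_tens !tens_dual_pure mulrC.
Qed.

Lemma tens_dual_assoc A B C (f : dual A) (g : dual B) (h : dual C) t :
  tens_dual f (tens_dual g h) (tassoc t) = tens_dual (tens_dual f g) h t.
Proof.
apply: (tens_ext (f := tens_dual f (tens_dual g h) \o @tassoc k A B C)
  (g := tens_dual (tens_dual f g) h)) => s c /=.
rewrite tens_dual_pure.
elim/tens_ind: s => [|s s' hs hs'|a b].
- by rewrite tens0l !linear0 mul0r.
- by rewrite tensDl !linearD /= hs hs' mulrDl.
by rewrite tassoc_tens !tens_dual_pure mulrA.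
Qed.

Lemma separate_vspace A (V : {vspace A}) (v : A) :
  (forall f : dual A, {in V, forall w, f w = 0} -> f v = 0) -> v \in V.
Proof.
move=> fV; suff /eqP : v - projv V v = 0.
  by rewrite subr_eq0 => /eqP ->; exact: memv_proj.
rewrite (coord_sum (v - _)) big1 // => i _.
have : (dcoord i \o (\1 - projv V))%VF v = 0.
  apply: (fV (dcoord i \o (\1 - projv V))%VF) => w wV.
  by rewrite comp_lfunE add_lfunE opp_lfunE id_lfunE projv_id // subrr linear0.
rewrite comp_lfunE dcoordE add_lfunE opp_lfunE id_lfunE => ->.
exact: scale0r.
Qed.

Lemma separate_dual A (I : {vspace dual A}) :
  (forall a, {in I, forall f : dual A, f a = 0} -> a = 0) -> I = fullv.
Proof.
(* Evaluation on a basis of I is injective on A, so dim A <= dim I. *)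
move=> Ia; pose ev (a : A) : 'rV[k]_(\dim I) :=
  \row_i ((vbasis I)`_i : dual A) a.
have ev_linear : linear ev.
  by move=> c u v; apply/rowP => i; rewrite !mxE linearP.
pose evL : {linear A -> 'rV[k]_(\dim I)} :=
  HB.pack ev (GRing.isLinear.Build k _ _ _ ev ev_linear).
have ev_inj : lker (linfun evL) == 0%VS.
  apply/lker0P => u v; rewrite (lfunE evL) [RHS](lfunE evL) => euv.
  have e0 : ev (u - v) = 0.
    by rewrite -[LHS]/(evL _) linearB [X in X - _]euv subrr.
  apply/eqP; rewrite -subr_eq0; apply/eqP/Ia => f fI.
  rewrite (coord_vbasis fI) sum_lfunE big1 // => i _; rewrite scale_lfunE.
  by move/rowP/(_ i): e0; rewrite !mxE => ->; rewrite scaler0.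
have := limg_ker_dim (linfun evL) fullv.
rewrite (eqP ev_inj) capv0 dimv0 add0n => dA.
apply/eqP; rewrite eqEdim subvf /=.
have -> : \dim {:dual A} = \dim {:A} by rewrite !dimvf /= /dim /= muln1.
rewrite -dA (leq_trans (dimvS (subvf _))) // dimvf /= /dim /= mul1n //.
Qed.

Lemma tens_in_tensv A B (V : {vspace A}) (W : {vspace B}) v w :
  v \in V -> w \in W -> v ⊗ w \in tensv V W.
Proof.
move=> vV wW; rewrite (coord_vbasis vV) tens_suml; apply: memv_suml => i _.
rewrite tensZl memvZ // (coord_vbasis wW) linear_sum; apply: memv_suml => j _.
rewrite linearZ memvZ //= memv_span //; apply/allpairsP.
exists ((vbasis V)`_i, (vbasis W)`_j).
by split; rewrite // mem_nth // size_tuple.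
Qed.

Lemma tensv_map A B C (V : {vspace A}) (W : {vspace B}) (X : {vspace C})
    (F : {linear (A ⊗ B)%type -> C}) t :
    (forall v w, v \in V -> w \in W -> F (v ⊗ w) \in X) ->
  t \in tensv V W -> F t \in X.
Proof.
move=> FX; suff /subvP VW : (tensv V W <= linfun F @^-1: X)%VS.
  by move=> /VW; rewrite -memv_preim lfunE.
apply/span_subvP => _ /allpairsP[[v w] [/= vV wW ->]].
by rewrite -memv_preim lfunE FX // vbasis_mem.
Qed.

Lemma left_contraction_dual A B (t : (A ⊗ B)%type) (f : dual A) (g : dual B) :
  f (left_contraction t g) = tens_dual f g t.
Proof.
rewrite lfunE /= [LHS]linear_tlift; apply: eq_tlift => a b.
by rewrite linearZ mulrC.
Qed.

(** The intersection of V ⊗ A and A ⊗ V is V ⊗ V, each of the two being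
    detected by contracting the other tensorand. *)
Lemma mem_tensv A (V : {vspace A}) (t : (A ⊗ A)%type) :
    (forall g, left_contraction t g \in V) ->
    (forall f, left_contraction (tswap t) f \in V) ->
  t \in tensv V V.
Proof.
move=> tV t'V.
have tl (f g : dual A) : {in V, forall v, f v = 0} -> tens_dual f g t = 0.
  by move=> fV; rewrite -left_contraction_dual fV.
have tr (f g : dual A) : {in V, forall v, g v = 0} -> tens_dual f g t = 0.
  by move=> gV; rewrite -tens_dual_swap -left_contraction_dual gV.
have -> : t = tmap (projv V) (projv V) t.
  apply: tens_dual_inj => f g.
  rewrite (tens_dual_map (f' := (f \o projv V)%VF) (g' := (g \o projv V)%VF));
    try by move=> x; rewrite comp_lfunE.
  have tD (f1 f2 : dual A) (g1 g2 : dual A) : tens_dual (f1 + f2) (g1 + g2) t =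
      tens_dual f1 g1 t + tens_dual f1 g2 t + tens_dual f2 (g1 + g2) t.
    pose s : dual (A ⊗ A)%type :=
      tens_dual f1 g1 + tens_dual f1 g2 + tens_dual f2 (g1 + g2).
    transitivity (s t); last by rewrite !add_lfunE.
    apply: (tens_ext (f := tens_dual (f1 + f2) (g1 + g2)) (g := s)) => a b.
    rewrite /= !add_lfunE !tens_dual_pure !add_lfunE mulrDl; congr (_ + _).
    by rewrite mulrDr.
  pose p (h : dual A) : dual A := (h \o projv V)%VF.
  rewrite -/(p f) -/(p g).
  rewrite -[in LHS](subrKC (p f) f) -[in LHS](subrKC (p g) g) tD.
  have h0 (h : dual A) : {in V, forall v, (h - p h) v = 0}.
    by move=> v vV; rewrite add_lfunE opp_lfunE comp_lfunE projv_id // subrr.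
  by rewrite (tr _ _ (h0 g)) (tl _ _ (h0 f)) !addr0.
rewrite (tensor_sum t) linear_sum; apply: memv_suml => i _.
rewrite linear_sum; apply: memv_suml => j _.
rewrite linearZ memvZ //= tmap_tens.
by apply: tens_in_tensv; exact: memv_proj.
Qed.

End TensorFunctionals.

Section SwapMorphism.
Variables (k : fieldType) (B : falgType k).

Lemma tswapM (s t : (B ⊗ B)%type) : tswap (s * t) = tswap s * tswap t.
Proof.
elim/tens_ind: s => [|s s' hs hs'|a b].
- by rewrite mul0r linear0 mul0r.
- by rewrite mulrDl !linearD /= hs hs' mulrDl.
elim/tens_ind: t => [|t t' ht ht'|a' b'].
- by rewrite mulr0 linear0 mulr0.
- by rewrite mulrDr !linearD /= ht ht' mulrDr.
by rewrite tensM !tswap_tens tensM.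
Qed.

Lemma tswap_unit (s : (B ⊗ B)%type) :
  s \is a GRing.unit -> tswap s \is a GRing.unit.
Proof.
move=> s_unit; apply/unitrP; exists (tswap s^-1).
by rewrite -!tswapM mulVr // mulrV // -tens11 tswap_tens.
Qed.

End SwapMorphism.

(** * The convolution algebra of a coalgebra *)

Section Convolution.
Variables (k : fieldType) (C : coalgType k).
Implicit Types (f g h : dual C).

Definition conv f g : dual C := (tens_dual f g \o comul)%VF.

Lemma convE f g x : conv f g x = tens_dual f g (comul x).
Proof. by rewrite comp_lfunE. Qed.

Lemma convDl : left_distributive conv +%R.
Proof.
move=> f g h; apply/lfunP => x; rewrite add_lfunE !comp_lfunE !lfunE /=.
by rewrite -tliftD; apply: eq_tlift => a b; rewrite add_lfunE mulrDl.
Qed.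

Lemma convDr : right_distributive conv +%R.
Proof.
move=> f g h; apply/lfunP => x; rewrite add_lfunE !comp_lfunE !lfunE /=.
by rewrite -tliftD; apply: eq_tlift => a b; rewrite add_lfunE mulrDr.
Qed.

Lemma convZl c f g : c *: conv f g = conv (c *: f) g.
Proof.
apply/lfunP => x; rewrite scale_lfunE !comp_lfunE !lfunE /=.
by rewrite -tliftZ; apply: eq_tlift => a b; rewrite scale_lfunE scalerAl.
Qed.

Lemma convZr c f g : c *: conv f g = conv f (c *: g).
Proof.
apply/lfunP => x; rewrite scale_lfunE !comp_lfunE !lfunE /=.
by rewrite -tliftZ; apply: eq_tlift => a b; rewrite scale_lfunE scalerAr.
Qed.

Lemma convA : associative conv.
Proof.
move=> f g h; apply/lfunP => x; rewrite !convE.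
rewrite -(tens_dual_map (u := idfun) (v := comul) (f := f)
  (g := tens_dual g h)) //; last by move=> a; rewrite convE.
rewrite -comulA tens_dual_assoc.
by apply: tens_dual_map => // a; rewrite convE.
Qed.

Lemma conv1l : left_id (counit : dual C) conv.
Proof.
move=> f; apply/lfunP => x; rewrite convE -{2}(counitl x) linear_tlift lfunE.
by apply: eq_tlift => a b; rewrite linearZ.
Qed.

Lemma conv1r : right_id (counit : dual C) conv.
Proof.
move=> f; apply/lfunP => x; rewrite convE -{2}(counitr x) linear_tlift lfunE.
by apply: eq_tlift => a b; rewrite linearZ mulrC.
Qed.

Lemma subcoalgebra_annihilator_ideal (V : {vspace C}) f g :
    subcoalgebra V -> {in V, forall v, f v = 0} ->
  {in V, forall v, conv f g v = 0 /\ conv g f v = 0}.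
Proof.
move=> VC fV v vV; rewrite !convE.
split; apply/eqP; rewrite -[_ == _]memv0;
  apply: (tensv_map _ (VC v vV)) => a b aV bV.
  by rewrite /= tens_dual_pure fV // mul0r mem0v.
by rewrite /= tens_dual_pure fV // mulr0 mem0v.
Qed.

(** The annihilator V of the two-sided ideal I generated by h is a subcoalgebra
    on which h vanishes.  It is not the whole coalgebra as h is nonzero, so it is
    zero, and then I is everything. *)
Lemma simple_coalgebra_conv h : simple_coalgebra C -> h != 0 ->
  exists t : (dual C ⊗ dual C)%type,
    tlift (fun a b => conv (conv a h) b) t = counit.
Proof.
move=> [_ C_simple] h0.
pose F : (dual C ⊗ dual C)%type -> dual C :=
  tlift (fun a b => conv (conv a h) b).
have FE a b : F (a ⊗ b) = conv (conv a h) b.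
  apply: tlift_tens => [y|y] c u v.
    by rewrite convDl -convZl convDl -convZl.
  by rewrite convDr -convZr.
pose I := limg (linfun F).
pose V := (\bigcap_(i < \dim I) lker (vbasis I)`_i)%VS.
have VP v : reflect {in I, forall f : dual C, f v = 0} (v \in V).
  apply: (iffP idP) => [vV f fI|vI].
    rewrite (coord_vbasis fI) sum_lfunE big1 // => i _.
    have /subv_bigcapP/(_ i isT) : (<[v]> <= V)%VS by rewrite -memvE.
    by rewrite scale_lfunE -memvE memv_ker => /eqP ->; rewrite scaler0.
  rewrite memvE; apply/subv_bigcapP => i _; rewrite -memvE memv_ker vI //.
  by rewrite vbasis_mem // mem_nth ?size_tuple.
have FI t : F t \in I by rewrite -[F t]lfunE memv_img ?memvf.
have I_ind (P : dual C -> Prop) : (forall a b, P (conv (conv a h) b)) ->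
    (forall f g, P f -> P g -> P (f + g)) -> P 0 -> {in I, forall f, P f}.
  move=> Ph PD P0 _ /memv_imgP[t _ ->]; rewrite lfunE /=.
  elim/tens_ind: t => [|s t hs ht|a b]; first by rewrite linear0.
    by rewrite linearD; apply: PD.
  by rewrite [X in P X]FE.
have Il f g : f \in I -> conv g f \in I.
  apply: (I_ind (fun f => conv g f \in I)) => [a b||].
  - by rewrite !convA -FE.
  - by move=> f1 f2 I1 I2; rewrite convDr rpredD.
  - by rewrite -(scale0r 0) -convZr scale0r mem0v.
have Ir f g : f \in I -> conv f g \in I.
  apply: (I_ind (fun f => conv f g \in I)) => [a b||].
  - by rewrite -convA -FE.
  - by move=> f1 f2 I1 I2; rewrite convDl rpredD.
  - by rewrite -(scale0r 0) -convZl scale0r mem0v.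
have VC : subcoalgebra V.
  move=> v /VP vI; apply: mem_tensv => g; apply/VP => f fI.
    by rewrite left_contraction_dual -convE vI ?Ir.
  by rewrite left_contraction_dual tens_dual_swap -convE vI ?Il.
have hI : h \in I by rewrite -(conv1l h) -(conv1r (conv _ _)) -FE.
have [V0|VT] := C_simple _ VC; last first.
  case/eqP: h0; apply/lfunP => v; rewrite zero_lfunE.
  by have /VP : v \in V by [rewrite VT memvf]; apply.
have IT : I = fullv.
  by apply: separate_dual => v vI; apply/eqP; rewrite -memv0 -V0; apply/VP.
have /memv_imgP[t _ ->] : (counit : dual C) \in I by rewrite IT memvf.
by exists t; rewrite lfunE.
Qed.
End Convolution.

(** * The Galois map of a twist *)

Section GaloisMap.
Variables (k : fieldType) (B : hopfType k) (J : twist B).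
Implicit Types (b c d : B) (s t : (B ⊗ B)%type).

(** The transpose of h ⊗ g |-> (b |-> h * (b . g)) for the algebra dual to B_J,
    where b . g is the right translate of g by b. *)
Definition galois_map : (B ⊗ B -> B ⊗ B)%type :=
  tlift (fun c b => comul c * twist_val J * (1 ⊗ b)).
HB.instance Definition _ :=
  GRing.isLinear.Build k (B ⊗ B)%type (B ⊗ B)%type _
  galois_map (tlift_is_linear _).

Lemma galois_map_tens c b :
  galois_map (c ⊗ b) = comul c * twist_val J * (1 ⊗ b).
Proof.
apply: tlift_tens => [y|y] a u v.
  by rewrite linearP /= !mulrDl -!scalerAl.
by rewrite linearP /= mulrDr -scalerAr.
Qed.

Definition mul_antipode : (B ⊗ B)%type -> B :=
  tlift (fun q r => q * antipode r).
HB.instance Definition _ := GRing.isLinear.Build k (B ⊗ B)%type B _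
  mul_antipode (tlift_is_linear _).

Lemma mul_antipode_tens b c : mul_antipode (b ⊗ c) = b * antipode c.
Proof.
apply: tlift_tens => [y|y] a u v.
  by rewrite mulrDl -scalerAl.
by rewrite linearP mulrDr -scalerAr.
Qed.

(* The map p ⊗ (q ⊗ r) |-> p ⊗ q antipode(r). *)
Local Notation F := (tmap idfun mul_antipode).

Lemma fold_antipode_assoc t d a b :
  F (tassoc (t ⊗ d) * (1 ⊗ (a ⊗ b))) =
  t * (1 ⊗ (a * antipode (d * b))).
Proof.
elim/tens_ind: t => [|s t hs ht|p q].
- by rewrite tens0l linear0 !mul0r linear0.
- by rewrite tensDl linearD /= !mulrDl linearD /= hs ht.
by rewrite tassoc_tens !tensM !tmap_tens /= mul_antipode_tens mulrA.
Qed.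

Lemma fold_antipode_comul t :
  F (tmap idfun comul t) =
  tlift (fun a b => (counit b : k) *: a) t ⊗ 1.
Proof.
elim/tens_ind: t => [|s t hs ht|p q].
- by rewrite !linear0 tens0l.
- by rewrite !linearD /= tensDl hs ht.
rewrite !tmap_tens /= /mul_antipode antipoder tlift_tens; last first.
- by move=> a c u v; rewrite linearP scalerDl -scalerA.
- by move=> a c u v; rewrite scalerDr !scalerA mulrC.
by rewrite linearZ /= tensZl.
Qed.

(** The image W is stable under left multiplication by Delta(B) and right
    multiplication by 1 ⊗ B.  The cocycle identity
    (Delta ⊗ id)(J) J_12 J_23^-1 = (id ⊗ Delta)(J), to which
    p ⊗ q ⊗ r |-> p ⊗ q antipode(r) is applied, puts the left side in W and
    turns the right side into 1 ⊗ 1.  Finally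
    u ⊗ b = Delta(u_1) (1 ⊗ antipode(u_2) b). *)
Lemma galois_map_surjective : limg (linfun galois_map) = fullv.
Proof.
set W := limg _.
have WP c b : comul c * twist_val J * (1 ⊗ b) \in W.
  by rewrite -galois_map_tens -[galois_map _]lfunE memv_img ?memvf.
have W_ind (P : (B ⊗ B)%type -> Prop) :
    P 0 -> (forall s t, P s -> P t -> P (s + t)) ->
    (forall c b, P (comul c * twist_val J * (1 ⊗ b))) -> {in W, forall t, P t}.
  move=> P0 PD Pt _ /memv_imgP[t _ ->]; rewrite lfunE /=.
  elim/tens_ind: t => [|s t hs ht|c b]; first by rewrite linear0.
    by rewrite linearD; apply: PD.
  by rewrite galois_map_tens.
have Wr t b : t \in W -> t * (1 ⊗ b) \in W.
  move: t; apply: W_ind => [|s t Ws Wt|c b'].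
  - by rewrite mul0r mem0v.
  - by rewrite mulrDl rpredD.
  by rewrite -[X in X \in W]mulrA tensM mul1r WP.
have Wl t c : t \in W -> comul c * t \in W.
  move: t; apply: W_ind => [|s t Ws Wt|c' b].
  - by rewrite mulr0 mem0v.
  - by rewrite mulrDr rpredD.
  by rewrite !mulrA -comulM WP.
have WJ s t :
    F (tassoc (tmap comul idfun s * (twist_val J ⊗ 1)) * (1 ⊗ t)) \in W.
  elim/tens_ind: s => [|s s' hs hs'|c d].
  - by rewrite linear0 mul0r linear0 mul0r linear0 mem0v.
  - by rewrite linearD /= mulrDl linearD /= mulrDl linearD rpredD.
  elim/tens_ind: t => [|t t' ht ht'|a b].
  - by rewrite linear0 mulr0 linear0 mem0v.
  - by rewrite linearD /= mulrDr linearD rpredD.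
  by rewrite tmap_tens tensM mulr1 fold_antipode_assoc WP.
have W1 : 1 \in W.
  have := WJ (twist_val J) (twist_val J)^-1.
  rewrite twist_cocycle -mulrA tensM mulrV ?twist_unit // mul1r [1 ⊗ 1]tens11.
  by rewrite mulr1 fold_antipode_comul twist_counitr tens11.
apply/eqP; rewrite eqEsubv subvf /=; apply/subvP => t _.
elim/tens_ind: t => [|s t hs ht|u b]; [exact: mem0v|exact: rpredD|].
have -> : u ⊗ b = F (tassoc (tmap comul idfun (comul u))) * (1 ⊗ b).
  by rewrite comulA fold_antipode_comul counitr tensM mulr1 mul1r.
apply: (Wr); elim/tens_ind: (comul u) => [|s t hs ht|c d].
- by rewrite !linear0 mem0v.
- by rewrite !linearD rpredD.
rewrite tmap_tens -[tassoc _]mulr1 -tens11 -tens11 fold_antipode_assoc.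
by apply: Wl; rewrite -[_ ⊗ _]mul1r Wr.
Qed.

(** The inverse of the Galois map, followed by eps ⊗ phi.  In terms of the dual
    algebra, Theta is a tensor sum_j h_j ⊗ g_j such that
    sum_j h_j * (b . g_j) = phi(b) 1. *)
Lemma galois_functional (phi : dual B) :
  exists Theta : dual (B ⊗ B)%type,
    forall c b, Theta (twisted_comul J c * (1 ⊗ b)) = (counit c : k) * phi b.
Proof.
have T_inj : lker (linfun galois_map) == 0%VS.
  rewrite -dimv_eq0; have := limg_ker_dim (linfun galois_map) fullv.
  rewrite galois_map_surjective capfv => /eqP.
  by rewrite -[X in _ == X]add0n eqn_add2r.
exists (tens_dual (counit : dual B) phi \o (linfun galois_map)^-1)%VF => c b.
rewrite comp_lfunE twisted_comulE -galois_map_tens -[galois_map _]lfunE.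
by rewrite lker0_lfunK // tens_dual_pure.
Qed.

End GaloisMap.

(** * The algebra dual to the twisted coalgebra *)

(** An alias, so that this product does not compete with the product that the
    dual of a Hopf algebra already has. *)
Definition twisted_dual (k : fieldType) (B : hopfType k) (J : twist B) : Type :=
  dual (twisted_coalgebra J).

Section TwistedDual.
Variables (k : fieldType) (B : hopfType k) (J : twist B).
Local Notation S := (twisted_dual J).
Local Notation BJ := (twisted_coalgebra J).

HB.instance Definition _ := Vector.copy S (dual BJ).

Lemma twisted_counit_neq0 : (counit : dual BJ) != 0.
Proof.
apply/eqP => /lfunP/(_ (1 : B))/eqP; rewrite zero_lfunE.
by rewrite -[counit _]/(counit (1 : B)) counit1 oner_eq0.
Qed.

HB.instance Definition _ := GRing.Zmodule_isNzRing.Build S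
  (@convA k BJ) (@conv1l k BJ) (@conv1r k BJ) (@convDl k BJ) (@convDr k BJ)
  twisted_counit_neq0.
HB.instance Definition _ := GRing.Lmodule_isLalgebra.Build k S (@convZl k BJ).
HB.instance Definition _ := GRing.Lalgebra_isAlgebra.Build k S (@convZr k BJ).
HB.instance Definition _ := Algebra_isFalgebra.Build k S.

Implicit Types (f g h : S).

Lemma twisted_dualM f g (x : B) :
  (f * g) x = tens_dual (f : dual B) (g : dual B) (twisted_comul J x).
Proof. exact: (convE (C := BJ)). Qed.

Lemma twisted_dual1 (x : B) : (1 : S) x = counit x.
Proof. by []. Qed.

Definition translate (b : B) (f : S) : S := ((f : dual B) \o amulr b)%VF.

Lemma translateE b f (x : B) : translate b f x = f (x * b).
Proof. by rewrite comp_lfunE lfunE. Qed.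

Lemma translate_bilinear :
  (forall f, linear (translate^~ f)) /\ (forall b, linear (translate b)).
Proof.
split=> [f|b] c u v; apply/lfunP => x.
  by rewrite add_lfunE scale_lfunE !translateE mulrDr -scalerAr linearP.
by rewrite !(add_lfunE, scale_lfunE, translateE).
Qed.

Hypothesis comulC : forall b : B, tswap (comul b) = comul b.

(** Cocommutativity gives Delta(x) J = (Delta(x) J)_21 J_21^-1 J; pairing both
    sides with f ⊗ g yields the two products. *)
Lemma braided_commutative f g :
  f * g = tlift (fun a b => translate b g * translate a f) (twist_rmatrix J).
Proof.
have [trl trr] := translate_bilinear.
apply/lfunP => x; rewrite twisted_dualM.
have -> : twisted_comul J x = tswap (twisted_comul J x) * twist_rmatrix J.
  rewrite twisted_comulE tswapM comulC /twist_rmatrix -!mulrA mulVKr //.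
  by rewrite tswap_unit ?twist_unit.
elim/tens_ind: (twist_rmatrix J) => [|s t hs ht|a b].
- by rewrite mulr0 !linear0 zero_lfunE.
- by rewrite mulrDr !linearD /= hs ht add_lfunE.
rewrite tlift_tens; first last.
- by move=> a' c u v; rewrite trl mulrDl -scalerAl.
- by move=> a' c u v; rewrite trl mulrDr -scalerAr.
rewrite twisted_dualM; elim/tens_ind: (twisted_comul J x) => [|s t hs ht|p q].
- by rewrite linear0 mul0r !linear0.
- by rewrite linearD mulrDl !linearD /= hs ht.
by rewrite tswap_tens tensM !tens_dual_pure !translateE mulrC.
Qed.

(** With Theta = sum_j h_j ⊗ g_j as in [galois_functional] and g_j the dual
    basis, braided commutativity gives
    sum_j h_j * f * g_j = sum_R (sum_j h_j * (R_2 . g_j)) * (R_1 . f)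
    = sum_R phi(R_2) (R_1 . f). *)
Lemma translate_two_sided (phi : dual B) :
  exists h : 'I_(\dim {:B}) -> S,
    (forall f, \sum_j h j * f * (dcoord j : dual B) =
               translate (left_contraction (twist_rmatrix J) phi) f) /\
    (h =1 (fun=> 0) -> phi = 0).
Proof.
have [trl trr] := translate_bilinear.
have [Theta ThetaE] := galois_functional J phi.
(* The swap is there only to make u |-> u ⊗ e_j a composite of linear maps. *)
pose h (j : 'I_(\dim {:B})) : S :=
  (Theta \o (linfun (@tswap k B B) \o linfun (tens (vbasis {:B})`_j)))%VF.
have hE j (u : B) : h j u = Theta (u ⊗ (vbasis {:B})`_j).
  by rewrite !comp_lfunE !lfunE /= tswap_tens.
have h_sum t b :
    \sum_j tens_dual (h j : dual B)
              (translate b (dcoord j : dual B) : dual B) t =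
    Theta (t * (1 ⊗ b)).
  elim/tens_ind: t => [|s t hs ht|p q].
  - by rewrite mul0r linear0 big1 // => j _; rewrite linear0.
  - rewrite mulrDl linearD /= -hs -ht -big_split.
    by apply: eq_bigr => j _; rewrite linearD.
  rewrite tensM mulr1 [q * b]coord_sum !linear_sum; apply: eq_bigr => j _.
  by rewrite tens_dual_pure translateE dcoordE hE !linearZ /= mulrC.
exists h; split=> [f|h0]; last first.
  (* phi is recovered from Theta, since Theta(J (1 ⊗ b)) = phi(b). *)
  apply/lfunP => b; rewrite zero_lfunE -[LHS]mul1r -(counit1 (s := B)).
  rewrite -ThetaE -h_sum.
  by rewrite big1 // => j _; rewrite h0; exact: tens_dual0l.
pose H b := \sum_j h j * translate b (dcoord j : dual B).
transitivity (tlift (fun a b => H b * translate a f) (twist_rmatrix J)).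
  under [RHS]eq_tlift do rewrite mulr_suml.
  rewrite -tlift_sumf; apply: eq_bigr => j _.
  rewrite -mulrA (braided_commutative f) [LHS](linear_tlift (h j \*o idfun)).
  by apply: eq_tlift => a b /=; rewrite mulrA.
have hT b : H b = (phi b : k) *: 1.
  apply/lfunP => u; rewrite scale_lfunE twisted_dual1 sum_lfunE.
  under eq_bigr do rewrite twisted_dualM.
  by rewrite h_sum ThetaE mulrC.
under eq_tlift do rewrite hT -scalerAl mul1r.
pose trf : {linear B -> S} := HB.pack (translate^~ f)
  (GRing.isLinear.Build k B S _ (translate^~ f) (trl f)).
rewrite /left_contraction [RHS](linear_tlift trf).
by apply: eq_tlift => a b; rewrite linearZ.
Qed.

Lemma minimal_nondegenerate : minimal_twist J -> nondegenerate_twist J.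
Proof.
move=> J_min; split=> [|V VC].
  apply/eqP => B0; have := memvf ((1 : B) : BJ).
  rewrite B0 memv0 => /eqP; exact/eqP/oner_neq0.
(* The same inclusion, read over B, of which B_J is an alias. *)
have VCB (v : B) : v \in V -> twisted_comul J v \in tensv V V by exact: VC.
(* If f vanishes on V, so do its two-sided multiples, among them its translate
   by b, whose value at v is f (v * b). *)
have Vr (v b : B) : v \in V -> v * b \in V.
  move=> vV; apply: separate_vspace => f fV.
  have : b \in left_tensorands (twist_rmatrix J) by rewrite J_min memvf.
  case/memv_imgP => phi _ ->; rewrite lfunE /=.
  have [h [hE _]] := translate_two_sided phi.
  rewrite -[LHS]translateE -hE sum_lfunE big1 // => j _.
  have hV : {in V, forall w, (h j * (f : S)) w = 0}.
    by move=> w /(subcoalgebra_annihilator_ideal (C := BJ) (h j) VC fV) [].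
  have [] // := subcoalgebra_annihilator_ideal (C := BJ)
    (dcoord j : dual B) VC hV vV.
have [->|V0] := eqVneq V 0%VS; [by left|right].
have [v vV ev] : exists2 v : B, v \in V & counit v != 0.
  have /subvPn[v vV] : ~~ (V <= lker (counit : 'Hom(BJ, k^o)))%VS.
    apply: contra V0 => /subvP Ve; rewrite -subv0; apply/subvP => v vV.
    rewrite -(twisted_counitl J v).
    apply: (tensv_map _ (VCB v vV)) => a b aV bV /=.
    have /eqP ea : counit a == 0 by rewrite -memv_ker Ve.
    rewrite tlift_tens ?ea ?scale0r ?mem0v // => [y|y] c u w.
      by rewrite linearP scalerDl -scalerA.
    by rewrite scalerDr !scalerA mulrC.
  by rewrite memv_ker; exists v.
have V1 : (1 : B) \in V.
  suff : (counit v : k) *: (1 : B) \in V by rewrite rpredZeq (negPf ev).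
  rewrite -antipoder -/(mul_antipode _).
  have -> : comul v = twisted_comul J v * (twist_val J)^-1.
    by rewrite twisted_comulE mulrK // twist_unit.
  move: (twist_val J)^-1 => s.
  apply: (tensv_map (F := @mul_antipode k B \o (s \o* idfun)) _
    (VCB v vV)) => a b aV bV /=.
  elim/tens_ind: s => [|s t hs ht|c d].
  - by rewrite mulr0 linear0 mem0v.
  - by rewrite mulrDr linearD rpredD.
  by rewrite tensM mul_antipode_tens !Vr.
apply/vspaceP => b; rewrite memvf -[b]mul1r; exact: Vr.
Qed.
End TwistedDual.

Lemma nondegenerate_minimal (k : closedFieldType) (B : hopfType k)
    (J : twist B) :
  (forall b : B, tswap (comul b) = comul b) ->
  nondegenerate_twist J -> minimal_twist J.
Proof.
move=> comulC J_nondeg.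
have S_simple : simple_algebra (twisted_dual J).
  by move=> h; exact: simple_coalgebra_conv.
have ker0 : lker (linfun (left_contraction (twist_rmatrix J))) == 0%VS.
  rewrite -subv0; apply/subvP => phi.
  rewrite memv_ker memv0 lfunE /= => /eqP phi0.
  have [h [hE h0]] := translate_two_sided J comulC phi.
  pose g (j : 'I_(\dim {:B})) : twisted_dual J := dcoord j : dual B.
  have gE (i j : 'I_(\dim {:B})) :
      (g j : dual B) (vbasis {:B})`_i = (i == j)%:R.
    by rewrite dcoordE Defs.coord_basis eq_sym.
  apply/eqP/h0/(@two_sided_mul_free k (twisted_dual J) S_simple _ g h)
    => [c|f]; last first.
    rewrite hE phi0; apply/lfunP => x.
    by rewrite translateE mulr0 linear0 zero_lfunE.
  move=> /lfunP c0 i; have := c0 (vbasis {:B})`_i.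
    rewrite sum_lfunE zero_lfunE (bigD1 i) //= big1 => [|j ji].
      by rewrite scale_lfunE gE eqxx addr0 => ci; rewrite -[c i]mulr1.
    by rewrite scale_lfunE gE eq_sym (negPf ji) scaler0.
apply/eqP; rewrite eqEdim subvf /=.
rewrite /left_tensorands limg_dim_eq ?(eqP ker0) ?capv0 //.
by rewrite !dimvf /= /dim /= muln1.
Qed.

Theorem proposition6p7 (k : closedFieldType) (G : finGroupScheme k)
    (J : twist (group_algebra G)) :
  minimal_twist J <-> nondegenerate_twist J.
Proof.
have comulC := @group_algebra_cocommutative k G.
split; [exact: minimal_nondegenerate | exact: nondegenerate_minimal].
Qed.
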